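(* Let $\mathbb{A}$ be a Banach algebra with unity $\mathbf{1}$ and let $\mathbb{M}$ be a unital Banach left $\mathbb{A}$-module. Let $\delta:\mathbb{A}\to\mathbb{M}$ be a continuous linear map such that for all $a,b\in\mathbb{A}$, \[ ab+ba=\mathbf{1} \ \Longrightarrow\ 2a\delta(b)+2b\delta(a)=\delta(\mathbf{1}). \] Then $\delta$ is a Jordan left derivation.
   Context: All algebras and vector spaces are over $\mathbb{F}$, where $\mathbb{F}$ is either $\mathbb{R}$ or $\mathbb{C}$. A linear map $\delta:\mathbb{A}\to\mathbb{M}$ from a unital algebra $\mathbb{A}$ to a left $\mathbb{A}$-module $\mathbb{M}$ is a Jordan left derivation if $\delta(ab+ba)=2a\delta(b)+2b\delta(a)$ for all $a,b\in\mathbb{A}$; equivalently, $\delta(a^2)=2a\delta(a)$ for all $a\in\mathbb{A}$. *)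

(* Defs.v *)
From HB Require Import structures.
From mathcomp Require Import all_boot all_order all_algebra.
From mathcomp Require Import all_classical all_reals all_analysis.
From mathcomp Require Import complex.

Set Implicit Arguments.
Unset Strict Implicit.
Unset Printing Implicit Defensive.

Import Order.TTheory GRing.Theory Num.Theory.
Import numFieldNormedType.Exports.

Local Open Scope ring_scope.

(* An index predicate rather than a disjunction of equalities, so that a case
   analysis substitutes the field in everything that depends on it. *)
Inductive real_or_complex (R : realType) : numFieldType -> Prop :=
| IsReal : real_or_complex R R
| IsComplex : real_or_complex R R[i].

(* Hierarchy Builder rejects a structure that joins GRing.Algebra and
   CompleteNormedModule (Num.NumDomain is already declared without an
   intermediate normed ring), so the multiplication is added to a complete
   normed space by hand; [A] is made a pzRingType just after.
   Neither 1 != 0 nor `|1| = 1 is required. *)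
HB.mixin Record CompleteNormedModule_isBanachAlgebra (K : numFieldType) A
    & CompleteNormedModule K A := {
  bmul : A -> A -> A ;
  bone : A ;
  bmulA : associative bmul ;
  bmul1l : left_id bone bmul ;
  bmul1r : right_id bone bmul ;
  bmul_bilinear : bilinear_for *:%R *:%R bmul ;
  ler_norm_bmul : forall a b : A, `|bmul a b| <= `|a| * `|b|
}.

#[short(type="banachAlgType")]
HB.structure Definition BanachAlgebra (K : numFieldType) :=
  {A of CompleteNormedModule K A & CompleteNormedModule_isBanachAlgebra K A}.

Section BanachAlgebraRing.
Variables (K : numFieldType) (A : banachAlgType K).

Let bmulDl : left_distributive (@bmul K A) +%R.
Proof. by move=> a b c; have := bmul_bilinear.1 c 1 a b; rewrite /= !scale1r. Qed.

Let bmulDr : right_distributive (@bmul K A) +%R.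
Proof. by move=> a b c; have := bmul_bilinear.2 a 1 b c; rewrite /= !scale1r. Qed.

HB.instance Definition _ := GRing.Zmodule_isPzRing.Build A
  (@bmulA K A) (@bmul1l K A) (@bmul1r K A) bmulDl bmulDr.

End BanachAlgebraRing.

(* The action of A has its own name [lact]: the library's [lmodType A] would
   put a second scaling [*:] on the K-vector space M. The action is bounded by
   some constant, not necessarily 1. *)
HB.mixin Record isUnitalBanachLeftModule (K : numFieldType)
    (A : banachAlgType K) M & CompleteNormedModule K M := {
  lact : A -> M -> M ;
  lact_bilinear : bilinear_for *:%R *:%R lact ;
  lactA : forall (a b : A) (m : M), lact (a * b) m = lact a (lact b m) ;
  lact1 : forall m : M, lact 1 m = m ;
  ler_norm_lact : exists C : K, forall (a : A) (m : M),
    `|lact a m| <= C * (`|a| * `|m|)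
}.

#[short(type="unitalBanachLeftModType")]
HB.structure Definition UnitalBanachLeftModule (K : numFieldType)
    (A : banachAlgType K) :=
  {M of CompleteNormedModule K M & isUnitalBanachLeftModule K A M}.

Definition jordan_left_derivation (K : numFieldType) (A : banachAlgType K)
    (M : unitalBanachLeftModType A) (delta : {linear A -> M}) : Prop :=
  forall a b : A,
    delta (a * b + b * a) = 2 *: lact a (delta b) + 2 *: lact b (delta a).

(* Main.v *)
(** Testing the hypothesis on [a = 1 - z], [b = y / 2] with [y] the inverse of
    [1 - z] gives [delta y = y^2 (delta z)] for every small [z]. Expanding [y]
    as [1 + z + z^2 y], the defect [D z = delta (z^2) - 2 z (delta z)] is then
    [O(|z|^3)]. Since [D] is homogeneous of degree 2, it vanishes, and
    polarising [D = 0] gives the result. *)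
Require Import Defs.
From mathcomp Require Import all_boot all_order all_algebra.
From mathcomp Require Import all_classical all_reals all_analysis.
From mathcomp Require Import complex ring.
Import Order.TTheory GRing.Theory Num.Theory.
Import numFieldNormedType.Exports.
Local Open Scope ring_scope.

(** * Powers of one half over the real and complex fields *)

(* [archiNumFieldType] cannot be used here: [R[i]] has no such instance. *)
Definition small_powers (K : numFieldType) : Prop :=
  forall e : K, 0 < e -> exists n, 2^-1 ^+ n < e.

Lemma small_powers_real (R : realType) : small_powers R.
Proof.
(* An archimedean bound [n] of [e^-1] satisfies [e^-1 < 2 ^+ n]; inverting gives the claim. *)
move=> e e0; have := @upper_nthrootP R e^-1 _ (leqnn _).
set n := Num.bound _ => h; exists n.
by rewrite exprVn -[e]invrK ltf_pV2 // posrE ?invr_gt0 // exprn_gt0.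
Qed.

Lemma small_powers_complex (R : realType) : small_powers R[i].
Proof.
(* Positivity in [R[i]] means zero imaginary part and positive real part, so the real case
   applies. *)
case=> a b; rewrite ltcE /= => /andP[/eqP-> a0].
have [n hn] := small_powers_real R a a0.
exists n; have := hn; rewrite -ltcR.
by rewrite !rmorphXn /= fmorphV rmorph_nat.
Qed.

Lemma real_or_complex_small_powers (R : realType) (K : numFieldType) :
  real_or_complex R K -> small_powers K.
Proof.
case; [exact: small_powers_real | exact: small_powers_complex].
Qed.

(** * Neumann series in a Banach algebra *)

Section BanachAlgebraTheory.
Context {K : numFieldType} {A : banachAlgType K}.
Implicit Types (a b c x z : A) (k : K).

Lemma ler_norm_mul a b : `|a * b| <= `|a| * `|b|.
Proof. exact: ler_norm_bmul. Qed.

Lemma scale_mull k a b : (k *: a) * b = k *: (a * b).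
Proof.
have := bmul_bilinear.1 b k a 0.
by rewrite /= !addr0 -[bmul 0 b]/(0 * b) mul0r addr0.
Qed.

Lemma scale_mulr k a b : a * (k *: b) = k *: (a * b).
Proof.
have := bmul_bilinear.2 a k b 0.
by rewrite /= !addr0 -[bmul a 0]/(a * 0) mulr0 addr0.
Qed.

Lemma continuous_mull a : continuous (fun b : A => a * b).
Proof.
move=> b; apply/cvgrPdist_le => e e0.
(* Adding 1 keeps the divisor positive when [a = 0]. *)
have a0 : 0 < 1 + `|a| by rewrite ltr_pwDl.
near=> c; rewrite -mulrBr (le_trans (ler_norm_mul _ _)) //.
rewrite (@le_trans _ _ ((1 + `|a|) * `|b - c|)) ?ler_wpM2r ?lerDr //.
rewrite mulrC -ler_pdivlMr //.
near: c; move: (e / _) (divr_gt0 e0 a0).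
exact/cvgrPdist_le/cvg_id.
Unshelve. all: by end_near. Qed.

Lemma continuous_mulr a : continuous (fun b : A => b * a).
Proof.
move=> b; apply/cvgrPdist_le => e e0.
have a0 : 0 < 1 + `|a| by rewrite ltr_pwDl.
near=> c; rewrite -mulrBl (le_trans (ler_norm_mul _ _)) //.
rewrite (@le_trans _ _ (`|b - c| * (1 + `|a|))) ?ler_wpM2l ?lerDr //.
rewrite -ler_pdivlMr //.
near: c; move: (e / _) (divr_gt0 e0 a0).
exact/cvgrPdist_le/cvg_id.
Unshelve. all: by end_near. Qed.

(** Exponents start at 1 because the norm of the unit may exceed 1. *)
Lemma ler_norm_expS z n : `|z ^+ n.+1| <= `|z| ^+ n.+1.
Proof.
elim: n => [|n IHn]; first by rewrite !expr1.
by rewrite exprS [leRHS]exprS (le_trans (ler_norm_mul _ _)) // ler_wpM2l.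
Qed.

(** Cauchy criterion: the terms are dominated by a geometric series of ratio 1/2, whose tail from
    index [n] is at most [2^-1 ^+ n]. *)
Lemma cvg_series_expS (hK : small_powers K) z : `|z| <= 2^-1 ->
  cvgn (series (fun n => z ^+ n.+1)).
Proof.
move=> hz; apply/cauchy_cvgP/cauchy_seriesP => e e0.
have [N hN] := hK e e0.
near=> n; apply: le_lt_trans hN.
have Nn : (N <= n.1)%N.
  near: n; exists ([set m | (N <= m)%N], setT)%classic; last by case=> ? ? [].
  by split; [exact: nbhs_infty_ge | exact: filterT].
apply: le_trans (ler_norm_sum _ _ _) _.
have h0 : 0 <= 2^-1 :> K by rewrite invr_ge0.
have h1 : 2^-1 <= 1 :> K by rewrite invf_le1 ?ler1n.
have [nn|/ltnW nn] := leqP n.2 n.1.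
  by rewrite big_geq // exprn_ge0.
apply: (@le_trans _ _ (2^-1 ^+ n.1)); last first.
  by rewrite ler_wiXn2l.
(* The dominating term [2^-1 ^+ k.+1] equals [2^-1 ^+ k - 2^-1 ^+ k.+1], so the sum telescopes. *)
apply: (@le_trans _ _ (\sum_(n.1 <= k < n.2) (- 2^-1 ^+ k.+1 - - 2^-1 ^+ k))).
  apply: ler_sum => k _; apply: le_trans (ler_norm_expS _ _) _.
  apply: (@le_trans _ _ (2^-1 ^+ k.+1)); first by rewrite lerXn2r ?nnegrE.
  by rewrite opprK exprS -subr_ge0 le_eqVlt; apply/orP; left; apply/eqP; field.
by rewrite telescope_sumr // opprK gerDr oppr_le0 exprn_ge0.
Unshelve. all: by end_near. Qed.

(* Neumann series: [1 + w] is the inverse of [1 - z]. *)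
Lemma quasi_inverse (hK : small_powers K) z : `|z| <= 2^-1 ->
  exists w : A, [/\ w = z + z * w, w = z + w * z & `|w| <= `|z| *+ 2].
Proof.
move=> hz; pose s := series (fun n => z ^+ n.+1).
have /cvg_ex[/= w sw] := cvg_series_expS hK z hz.
(* Since [s n.+1 = z + z * s n = z + s n * z], uniqueness of limits yields both equations for
   [w]. *)
have sw1 : (s n.+1 @[n --> \oo] --> w)%classic by rewrite cvg_shiftS.
have wl : w = z + z * w.
  apply: (cvg_unique (@norm_hausdorff _ _) sw1).
  have -> : (fun n => s n.+1) = (fun n => z + z * s n).
    apply/funext => n; rewrite /s /series /= big_nat_recl // expr1.
    by congr (_ + _); rewrite mulr_sumr; apply: eq_bigr => i _; rewrite -exprS.
  apply: cvgD; first exact: cvg_cst.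
  exact: (cvg_comp _ _ sw (continuous_mull z w)).
have wr : w = z + w * z.
  apply: (cvg_unique (@norm_hausdorff _ _) sw1).
  have -> : (fun n => s n.+1) = (fun n => z + s n * z).
    apply/funext => n; rewrite /s /series /= big_nat_recl // expr1.
    by congr (_ + _); rewrite mulr_suml; apply: eq_bigr => i _; rewrite -exprSr.
  apply: cvgD; first exact: cvg_cst.
  exact: (cvg_comp _ _ sw (continuous_mulr z w)).
exists w; split=> //.
(* The equation for [w] bounds its norm by that of [z] plus half of itself; absorbing the half gives
   the factor 2. *)
have h : `|w| <= `|z| + 2^-1 * `|w|.
  rewrite {1}wl (le_trans (ler_normD _ _)) // lerD2l.
  by rewrite (le_trans (ler_norm_mul _ _)) // ler_wpM2r.
rewrite -(@ler_pM2l _ 2^-1) ?invr_gt0 //.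
have -> : 2^-1 * (`|z| *+ 2) = `|z| by rewrite -mulr_natr; field.
have -> : 2^-1 * `|w| = `|w| - 2^-1 * `|w| by field.
by rewrite lerBlDr.
Qed.

End BanachAlgebraTheory.

(** * Bounds for the module action and for continuous linear maps *)

Section LeftModuleTheory.
Context {K : numFieldType} {A : banachAlgType K}.
Context {M : unitalBanachLeftModType A}.
Implicit Types (a b : A) (m n : M) (k : K).

Lemma lactDl a b m : lact (a + b) m = lact a m + lact b m.
Proof. by have := lact_bilinear.1 m 1 a b; rewrite /= !scale1r. Qed.

Lemma lactDr a m n : lact a (m + n) = lact a m + lact a n.
Proof. by have := lact_bilinear.2 a 1 m n; rewrite /= !scale1r. Qed.

Lemma lact0l m : lact (0 : A) m = 0.
Proof. by apply: (addIr (lact 0 m)); rewrite -lactDl !add0r. Qed.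

Lemma lact0r a : lact a (0 : M) = 0.
Proof. by apply: (addIr (lact a 0)); rewrite -lactDr !add0r. Qed.

Lemma lactZl k a m : lact (k *: a) m = k *: lact a m.
Proof.
by have := lact_bilinear.1 m k a 0; rewrite /= !addr0 lact0l addr0.
Qed.

Lemma lactZr k a m : lact a (k *: m) = k *: lact a m.
Proof.
by have := lact_bilinear.2 a k m 0; rewrite /= !addr0 lact0r addr0.
Qed.

Lemma lactNr a m : lact a (- m) = - lact a m.
Proof. by rewrite -scaleN1r lactZr scaleN1r. Qed.

(** The constant of the module axiom has no prescribed sign. Its product with the norms dominates a
    norm, hence equals its own norm, so [C] can be replaced by its norm. *)
Lemma lact_bounded :
  exists2 C : K, 0 <= C & forall a m, `|lact a m| <= C * (`|a| * `|m|).
Proof.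
have [C hC] := @ler_norm_lact K A M.
exists `|C| => // a m.
have h0 : 0 <= C * (`|a| * `|m|) by apply: le_trans (hC a m).
apply: le_trans (hC a m) _.
by rewrite -{1}(ger0_norm h0) normrM (ger0_norm (mulr_ge0 _ _)).
Qed.

End LeftModuleTheory.

Lemma continuous_linear_le {K : numFieldType} {V W : normedModType K}
    (f : {linear V -> W}) : continuous f ->
  exists2 r : K, 0 <= r & forall v, `|f v| <= r * `|v|.
Proof.
move=> /linear_bounded_continuous/linear_boundedP h.
near +oo_K => r; exists r; first by near: r; exact: nbhs_pinfty_ge.
by near: r.
Unshelve. all: by end_near. Qed.

(** * Vanishing of the defect *)

Section JordanLeftDefect.
Context {K : numFieldType} {A : banachAlgType K}.
Context {M : unitalBanachLeftModType A} (delta : {linear A -> M}).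
Hypothesis delta_inv : forall a b : A, a * b + b * a = 1 ->
  2 *: lact a (delta b) + 2 *: lact b (delta a) = delta 1.

Definition jordan_left_defect (z : A) : M :=
  delta (z * z) - 2 *: lact z (delta z).

(** For [a = 1] and [b = 2^-1 *: 1] the hypothesis reads [delta 1 + delta 1 = delta 1]. *)
Lemma delta1 : delta 1 = 0.
Proof.
have : 2 *: lact (1 : A) (delta (2^-1 *: (1 : A))) +
    2 *: lact (2^-1 *: (1 : A)) (delta 1) = delta 1.
  apply: delta_inv; rewrite mul1r mulr1 -scalerDl.
  by rewrite (_ : _ + _ = 1 :> K) ?scale1r //; field.
rewrite linearZ /= lact1 lactZl lact1 scalerA divff ?pnatr_eq0 // scale1r.
by move/(canRL (addrK _)); rewrite subrr.
Qed.

Lemma delta_quasi_inverse (z w : A) : w = z + z * w -> w = z + w * z ->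
  delta w = lact ((1 + w) * (1 + w)) (delta z).
Proof.
move=> wl wr.
have yl : (1 - z) * (1 + w) = 1.
  by rewrite mulrDr mulr1 mulrBl mul1r {1}wl addrK subrK.
have yr : (1 + w) * (1 - z) = 1.
  by rewrite mulrDl mul1r mulrBr mulr1 {1}wr addrK subrK.
have : 2 *: lact (1 - z) (delta (2^-1 *: (1 + w))) +
    2 *: lact (2^-1 *: (1 + w)) (delta (1 - z)) = delta 1.
  apply: delta_inv; rewrite scale_mulr scale_mull yl yr -scalerDl.
  by rewrite (_ : _ + _ = 1 :> K) ?scale1r //; field.
(* What remains is [(1 - z) (delta w) = (1 + w) (delta z)]; acting by [1 + w] isolates [delta w]. *)
rewrite linearZ linearB linearD /= delta1 !add0r lactZr lactZl !scalerA.
rewrite divff ?pnatr_eq0 // !scale1r lactNr => /subr0_eq h.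
by rewrite lactA -h -lactA yr lact1.
Qed.

(** All terms of order below 3 in [z] cancel: as [w] is of the order of [z], both terms on the right
    are cubic. *)
Lemma jordan_left_defectE (z w : A) : w = z + z * w -> w = z + w * z ->
  jordan_left_defect z =
  lact (w * w + w *+ 3) (lact z (delta z)) - delta (z * (z * w)).
Proof.
move=> wl wr.
(* A factor [z] is kept on the right so that it acts on [delta z] first; the summand [z *+ 2]
   cancels the subtracted term of the defect. *)
have hsq : (1 + w) * (1 + w) = 1 + (w * w + w *+ 3) * z + z *+ 2.
  have e : w * w + w *+ 2 = (w * w + w *+ 3) * z + z *+ 2.
    rewrite mulrDl mulrnAl -mulrA; move pE: (w * z) wr => p wr.
    rewrite {2 3}wr mulrDr mulrnDl pE [p *+ 3]mulrS -[RHS]addrA -[LHS]addrA.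
    rewrite addrCA; congr (_ + _); rewrite -[RHS]addrA.
    by congr (_ + _); rewrite addrC.
  rewrite -[RHS]addrA -e mulrDl mul1r mulrDr mulr1 mulr2n -[LHS]addrA.
  by congr (_ + _); rewrite addrA addrC.
have : delta (z * z) = delta w - delta z - delta (z * (z * w)).
  (* Two substitutions give [w = z + (z * z + z * (z * w))]. *)
  rewrite {1}wl {1}wl mulrDr !linearD /=.
  by rewrite [delta z + _]addrC !addrK.
rewrite (delta_quasi_inverse z w wl wr) hsq /jordan_left_defect => ->.
rewrite (lactDl (1 + _)) (lactDl 1) lact1 lactA mulr2n (lactDl z z).
rewrite scaler_nat mulr2n addrAC; congr (_ - _).
by rewrite addrAC addrK [delta z + _]addrC addrK.
Qed.

Lemma jordan_left_defect_small (hK : small_powers K) :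
  continuous delta -> exists2 C : K, 0 <= C &
    forall z, `|z| <= 2^-1 -> `|jordan_left_defect z| <= C * `|z| ^+ 3.
Proof.
move=> /continuous_linear_le[r r0 hr].
have [C C0 hC] := @lact_bounded K A M.
(* As [w] has norm at most 1 and at most twice that of [z], [w * w + w *+ 3] costs 8. The two
   actions cost [C] each and [delta] costs [r]; the last term costs [2 * r]. *)
exists (8 * C * (C * r) + 2 * r) => [|z hz].
  by rewrite addr_ge0 // !mulr_ge0.
have [w [wl wr wz]] := quasi_inverse hK z hz.
have w1 : `|w| <= 1.
  apply: le_trans wz _; rewrite -mulr_natr -ler_pdivlMr ?ltr0n //.
  by rewrite mul1r.
rewrite (jordan_left_defectE z w wl wr) (le_trans (ler_normB _ _)) //.
rewrite mulrDl lerD //; last first.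
  rewrite (le_trans (hr _)) // [2 * r]mulrC -mulrA ler_wpM2l //.
  rewrite (le_trans (ler_norm_mul _ _)) // exprS mulrCA ler_wpM2l //.
  rewrite (le_trans (ler_norm_mul _ _)) // expr2 mulrCA ler_wpM2l //.
  by rewrite mulr_natl.
rewrite (le_trans (hC _ _)) // -!mulrA [8 * _]mulrCA ler_wpM2l //.
have hw : `|w * w + w *+ 3| <= 8 * `|z|.
  rewrite (le_trans (ler_normD _ _)) //.
  apply: (@le_trans _ _ (`|w| + `|w| *+ 3)).
    rewrite lerD // ?normrMn // (le_trans (ler_norm_mul _ _)) //.
    by rewrite ler_piMl.
  rewrite -mulrS (_ : 8 * `|z| = (`|z| *+ 2) *+ 4) ?lerMn2r //.
  by rewrite -mulrnA mulr_natl.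
have hm : `|lact z (delta z)| <= C * (`|z| * (r * `|z|)).
  by rewrite (le_trans (hC _ _)) // ler_wpM2l // ler_wpM2l.
apply: le_trans (ler_pM _ _ hw hm) _ => //.
by rewrite le_eqVlt; apply/orP; left; apply/eqP; ring.
Qed.

Lemma jordan_left_defectZ k z :
  jordan_left_defect (k *: z) = k ^+ 2 *: jordan_left_defect z.
Proof.
rewrite /jordan_left_defect scale_mull scale_mulr ![delta (k *: _)]linearZ /= lactZl lactZr.
by rewrite scalerBr !scalerA expr2 [2 * _]mulrC.
Qed.

(** Scaling [x] by [t] multiplies the defect by [t ^+ 2] but its bound by [t ^+ 3], a contradiction
    for small [t] if the defect is nonzero. *)
Lemma jordan_left_defect_eq0 (hK : small_powers K) :
  continuous delta -> forall x, jordan_left_defect x = 0.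
Proof.
move=> /(jordan_left_defect_small hK)[C C0 hC] x.
apply/eqP/negPn/negP; rewrite -normr_gt0; set d := `|_| => d0.
(* The added 1 makes the divisor positive and the final chain [d < d] strict. *)
have c0 : 0 < C * `|x| ^+ 3 + 1 by rewrite ltr_wpDl // mulr_ge0 // exprn_ge0.
have x0 : 0 < 2 * (1 + `|x|) by rewrite mulr_gt0 // ltr_pwDl.
have [n1 hn1] := hK _ (divr_gt0 ltr01 x0).
have [n2 hn2] := hK _ (divr_gt0 d0 c0).
have pow_le1 n : 2^-1 ^+ n <= 1 :> K.
  by rewrite exprn_ile1 ?invr_ge0 // invf_le1 ?ler1n.
have pow_gt0 n : 0 < 2^-1 ^+ n :> K by rewrite exprn_gt0 // invr_gt0.
(* Adding exponents meets both demands at once, each power being at most 1: [t *: x] lies in the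
   ball of radius 1/2, and the cubic bound falls below [d]. *)
pose t : K := 2^-1 ^+ (n1 + n2).
have t0 : 0 < t by exact: pow_gt0.
have t1 : t < 1 / (2 * (1 + `|x|)).
  by apply: le_lt_trans hn1; rewrite /t exprD ler_piMr // ltW.
have t2 : t < d / (C * `|x| ^+ 3 + 1).
  by apply: le_lt_trans hn2; rewrite /t exprD ler_piMl // ltW.
clearbody t; have : `|jordan_left_defect (t *: x)| <= C * `|t *: x| ^+ 3.
  apply: hC; rewrite normrZ gtr0_norm //.
  move: t1; rewrite ltr_pdivlMr // mulrCA => /ltW t1.
  rewrite -(@ler_pM2l _ 2) // divff ?pnatr_eq0 //.
  apply: le_trans t1; rewrite ler_pM2l // ler_pM2l //.
  by rewrite lerDr.
rewrite jordan_left_defectZ !normrZ (gtr0_norm t0) -/d.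
have -> : C * (t * `|x|) ^+ 3 = t * t * (t * (C * `|x| ^+ 3)) by ring.
rewrite ler_pM2l ?mulr_gt0 // => hd.
move: t2; rewrite ltr_pdivlMr // mulrDr mulr1 => t2.
suff : d < d by rewrite ltxx.
by apply: le_lt_trans hd (lt_trans _ t2); rewrite ltrDl.
Qed.

Lemma jordan_left_derivation_defect :
  (forall x, jordan_left_defect x = 0) -> jordan_left_derivation delta.
Proof.
move=> D0 a b.
have sq x : delta (x * x) = 2 *: lact x (delta x) by exact/subr0_eq/D0.
have := sq (a + b).
have -> : (a + b) * (a + b) = a * a + b * b + (a * b + b * a).
  rewrite mulrDl !mulrDr -addrA [RHS]addrAC -[RHS]addrA.
  by congr (_ + _); rewrite addrA.
rewrite ![delta (_ + _)]linearD !sq lactDl !lactDr !scalerDr.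
rewrite -!addrA => /addrI h; apply: (addrI (2 *: lact b (delta b))).
by rewrite h addrA addrC.
Qed.

End JordanLeftDefect.

Theorem proposition2p2 (R : realType) (F : numFieldType)
  (hF : real_or_complex R F)
  (A : banachAlgType F) (M : unitalBanachLeftModType A)
  (delta : {linear A -> M}) (delta_cont : continuous delta)
  (hdelta : forall a b : A, a * b + b * a = 1 ->
    2 *: lact a (delta b) + 2 *: lact b (delta a) = delta 1) :
  jordan_left_derivation delta.
Proof.
apply: jordan_left_derivation_defect => x.
(* The choice of field enters only through the smallness of the powers of 1/2. *)
have hK := real_or_complex_small_powers R F hF.
exact: (jordan_left_defect_eq0 delta hdelta hK delta_cont).
Qed.
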